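(* Let $\Delta=\bigsqcup_{i\in\mathbb Z}\Delta(i)$ be a $\mathbb Z$-grading of an irreducible reduced crystallographic root system with compatible positive system and simple roots $\Pi$. Let $I$ be a lower ideal of $\Delta(1)$, $I^c=\Delta(1)\setminus I$, and $\gamma\in\Delta(1)$. Then $\gamma$ is a minimal element of $I^c$ (with respect to $\preccurlyeq$) if and only if $w_{I,\max}(\gamma)\in\Pi$.
   Context: A $\mathbb Z$-grading: $\Delta=\bigsqcup_i\Delta(i)$ with $\gamma_1+\gamma_2\in\Delta(i_1+i_2)$ whenever $\gamma_j\in\Delta(i_j)$ and $\gamma_1+\gamma_2\in\Delta$; compatibility: $\Delta^+=\Delta(0)^+\sqcup\bigsqcup_{i\ge1}\Delta(i)$ with $\Delta(0)^+$ a positive system of $\Delta(0)$; $\Delta(\ge1)=\bigsqcup_{j\ge1}\Delta(j)$. Order: $\mu\preccurlyeq\gamma$ iff $\gamma-\mu$ is a nonnegative integer combination of simple roots; lower ideals of $\Delta(1)$ are its downward closed subsets. $N(w)=\{\gamma\in\Delta^+\mid w(\gamma)\in-\Delta^+\}$. For $J\subset\Delta^+$: $J^1=J$, $J^k=(J+J^{k-1})\cap\Delta$, $\langle J\rangle=\bigcup_{k\ge1}J^k$. $w_{I,\max}$ is the unique element $w$ of the Weyl group with $N(w)=\Delta(\ge1)\setminus\langle I^c\rangle$. *)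

(* Defs.v *)
From HB Require Import structures.
From mathcomp Require Import all_boot all_order all_algebra sesquilinear.
From mathcomp Require Import boolp classical_sets functions cardinality.

Set Implicit Arguments.
Unset Strict Implicit.
Unset Printing Implicit Defensive.

Import Order.TTheory GRing.Theory Num.Theory.
Local Open Scope classical_set_scope.
Local Open Scope ring_scope.

(* A Euclidean space is a finite-dimensional space V with a form
   dot : {dot V for idfun}, i.e. symmetric, bilinear and positive definite. *)

Definition cartan (R : realFieldType) (V : vectType R)
    (dot : {dot V for idfun}) (b a : V) : R :=
  2 * dot b a / dot a a.

Definition reflection (R : realFieldType) (V : vectType R)
    (dot : {dot V for idfun}) (a : V) : V -> V :=
  fun v => v - cartan dot v a *: a.

Record root_system (R : realFieldType) (V : vectType R)
    (dot : {dot V for idfun}) (Delta : set V) : Prop := {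
  rs_finite : finite_set Delta;
  rs_neq0 : forall a, Delta a -> a <> 0;
  rs_span : forall U : {vspace V},
    (forall a, Delta a -> a \in U) -> U = fullv;
  rs_reflection : forall a b, Delta a -> Delta b ->
    Delta (reflection dot a b) }.

Definition crystallographic (R : realFieldType) (V : vectType R)
    (dot : {dot V for idfun}) (Delta : set V) : Prop :=
  forall a b, Delta a -> Delta b -> exists z : int, cartan dot b a = z%:~R.

Definition reduced (R : realFieldType) (V : vectType R) (Delta : set V) : Prop :=
  forall (a : V) (c : R), Delta a -> Delta (c *: a) -> c = 1 \/ c = -1.

Definition irreducible_roots (R : realFieldType) (V : vectType R)
    (dot : {dot V for idfun}) (Delta : set V) : Prop :=
  Delta !=set0 /\
  forall A B : set V, A `|` B = Delta ->
    (forall a b, A a -> B b -> dot a b = 0) -> A = set0 \/ B = set0.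

(* Positive systems are taken in Weyl chamber form: the roots on the positive
   side of a hyperplane v^perp that contains no root.  The definition is applied
   to Delta as well as to its subset Delta(0). *)
Definition positive_system (R : realFieldType) (V : vectType R)
    (dot : {dot V for idfun}) (Delta P : set V) : Prop :=
  exists v : V, (forall a, Delta a -> dot v a <> 0) /\
    P = [set a | Delta a /\ 0 < dot v a].

Definition simple_roots (R : realFieldType) (V : vectType R) (P : set V) : set V :=
  [set a | P a /\ ~ exists b c, [/\ P b, P c & a = b + c]].

(* The submonoid generated by the reflections; it is the group they generate,
   since each reflection is its own inverse. *)
Inductive weyl (R : realFieldType) (V : vectType R)
    (dot : {dot V for idfun}) (Delta : set V) : set (V -> V) :=
| weyl_id : weyl dot Delta idfun
| weyl_refl a w : Delta a -> weyl dot Delta w ->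
    weyl dot Delta (reflection dot a \o w).

Record grading (R : realFieldType) (V : vectType R)
    (Delta : set V) (D : int -> set V) : Prop := {
  gr_cover : \bigcup_i D i = Delta;
  gr_disjoint : trivIset setT D;
  gr_add : forall i j a b, D i a -> D j b -> Delta (a + b) -> D (i + j) (a + b) }.

Definition deg_ge1 (R : realFieldType) (V : vectType R)
    (D : int -> set V) : set V :=
  \bigcup_(i in [set i : int | 1 <= i]) D i.

(* The union is disjoint because P0 is contained in D 0. *)
Definition compatible (R : realFieldType) (V : vectType R)
    (dot : {dot V for idfun}) (D : int -> set V) (P : set V) : Prop :=
  exists P0 : set V, positive_system dot (D 0) P0 /\ P = P0 `|` deg_ge1 D.

Definition root_le (R : realFieldType) (V : vectType R)
    (Pi : set V) (m g : V) : Prop :=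
  exists (s : seq V) (c : V -> nat),
    (forall a, a \in s -> Pi a) /\ g - m = \sum_(a <- s) a *+ c a.

Definition lower_ideal (R : realFieldType) (V : vectType R)
    (Pi S I : set V) : Prop :=
  I `<=` S /\ forall m g, I g -> S m -> root_le Pi m g -> I m.

Definition minimal_in (R : realFieldType) (V : vectType R)
    (Pi S : set V) (g : V) : Prop :=
  S g /\ forall m, S m -> root_le Pi m g -> m = g.

Definition inversions (R : realFieldType) (V : vectType R)
    (P : set V) (w : V -> V) : set V :=
  [set g | P g /\ [set - a | a in P] (w g)].

(* J^k for k >= 1; the value at k = 0 is never used. *)
Fixpoint root_power (R : realFieldType) (V : vectType R)
    (Delta J : set V) (k : nat) : set V :=
  match k with
  | 0%N => set0
  | 1%N => J
  | k'.+1 => [set a + b | a in J & b in root_power Delta J k'] `&` Delta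
  end.

Definition root_closure (R : realFieldType) (V : vectType R)
    (Delta J : set V) : set V :=
  \bigcup_(k in [set k | (1 <= k)%N]) root_power Delta J k.

Definition is_w_max (R : realFieldType) (V : vectType R)
    (dot : {dot V for idfun}) (Delta : set V) (D : int -> set V) (P I : set V)
    (w : V -> V) : Prop :=
  weyl dot Delta w /\
  inversions P w = deg_ge1 D `\` root_closure Delta (D 1 `\` I).

(* Main.v *)
(* Write J for the complement of I in Delta(1) and w for w_max.  By definition of
   w, a positive root has a positive image under w exactly when it lies in
   Delta(0) or in the closure of J.

   If g in J is not minimal, moving along simple roots between m < g in J gives
   g = a + b with a in Delta(0)^+ and b in J, so w g is a sum of two positive
   roots.

   Conversely, let g be minimal and w g = w b + w c with w b, w c positive.  If b
   and c are both positive, one of them has degree 0 and the other lies in J and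
   below g.  Otherwise, say, n = - b is an inversion of w, so n is not in the
   closure of J although g + n = c is.  This is impossible: by induction on k,
   g + n in J^(k+1) implies n in J^k.  Indeed, if g + n = c' + d with c' in J and
   d in J^k, then c' - g or d - g is a root or zero; in the first case
   n = (c' - g) + d with c' - g in Delta(0)^+ by minimality, and J^k is stable
   under such additions; in the second case n = c' + (d - g) and the induction
   hypothesis applies to d = g + (d - g). *)
Require Import Defs.
From HB Require Import structures.
From mathcomp Require Import all_boot all_order all_algebra sesquilinear.
From mathcomp Require Import boolp classical_sets functions cardinality.
From mathcomp Require Import zify ring lra.
Import Order.TTheory GRing.Theory Num.Theory.
Local Open Scope classical_set_scope.
Local Open Scope ring_scope.

(** * Reflections, and sums and differences of roots *)

Section RootSystem.
Context {R : realFieldType} {V : vectType R} {dot : {dot V for idfun}}.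
Implicit Types (a b x y : V).

Lemma dotC a b : dot a b = dot b a.
Proof. by rewrite hermC expr0 mul1r. Qed.

Lemma dot_sumr a (t : seq V) : dot a (\sum_(b <- t) b) = \sum_(b <- t) dot a b.
Proof. exact: linear_sumr. Qed.

Lemma dot_gt0 {a} : a <> 0 -> 0 < dot a a.
Proof. by move=> /eqP; exact: neq0_dnorm_gt0. Qed.

Lemma reflection_linear a : linear (reflection dot a).
Proof.
move=> k x y; rewrite /reflection /cartan linearDl linearZl_LR /=.
rewrite scalerBr scalerA addrACA -opprD -scalerDl; congr (_ - _ *: _).
by rewrite mulrDr mulrDl mulrCA !mulrA.
Qed.

Lemma reflectionK {a} : a <> 0 -> involutive (reflection dot a).
Proof.
move=> /dot_gt0 a0 x; rewrite /reflection /cartan linearBl linearZl_LR /=.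
rewrite -addrA -opprD -scalerDl; set k := (X in X *: a).
suff -> : k = 0 by rewrite scale0r subr0.
by rewrite /k; field; rewrite gt_eqF.
Qed.

Lemma dot_sum_gt0 a (t : seq V) :
  0 < dot a (\sum_(b <- t) b) -> exists2 b, b \in t & 0 < dot a b.
Proof.
rewrite dot_sumr => h; apply: contrapT => hn; move: h; apply/negP; rewrite -leNgt.
rewrite big_seq -oppr_ge0 -sumrN; apply: sumr_ge0 => b bt; rewrite oppr_ge0 leNgt.
by apply/negP => hb; apply: hn; exists b.
Qed.

Context {Delta : set V}.
Context (rsD : root_system dot Delta) (cryD : crystallographic dot Delta).

Lemma rootN {a} : Delta a -> Delta (- a).
Proof.
move=> Da; have := rs_reflection rsD Da Da; congr Delta.
rewrite /reflection /cartan mulfK ?gt_eqF ?dot_gt0 //; last exact: (rs_neq0 rsD).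
by rewrite scaler_nat mulr2n opprD addNKr.
Qed.

Lemma root_subN {a b} : Delta (a - b) -> Delta (b - a).
Proof. by move=> /rootN; rewrite opprB. Qed.

(** Both Cartan integers are positive. If one is 1, the corresponding reflection yields [a - b] up
    to sign; if both are at least 2, then [dot a a] and [dot b b] are at most [dot a b], so [a - b]
    has norm at most 0. *)
Lemma root_sub {a b} : Delta a -> Delta b -> 0 < dot a b -> a <> b -> Delta (a - b).
Proof.
move=> Da Db ab0 neq.
have a0 := dot_gt0 (rs_neq0 rsD Da); have b0 := dot_gt0 (rs_neq0 rsD Db).
have cart x y : Delta x -> Delta y -> 0 < dot x y ->
    cartan dot x y = 1 \/ dot y y <= dot x y.
  move=> Dx Dy xy0; have [z ez] := cryD _ _ Dy Dx.
  have y0 := dot_gt0 (rs_neq0 rsD Dy).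
  have z0 : 0 < z.
    by rewrite -(ltr0z R) -ez /cartan divr_gt0 // mulr_gt0.
  have [z1|] := eqVneq z 1; first by left; rewrite ez z1.
  move=> zn1; right; have z2 : 2 <= z by move/eqP: zn1; lia.
  have : 2 <= cartan dot x y by rewrite ez (ler_int _ 2).
  by rewrite /cartan ler_pdivlMr // ler_pM2l.
have [|hab] := cart a b Da Db ab0.
  by have := rs_reflection rsD Db Da; rewrite /reflection => /[swap] ->; rewrite scale1r.
rewrite dotC in ab0; have [|hba] := cart b a Db Da ab0.
  have := rs_reflection rsD Da Db; rewrite /reflection => /[swap] ->.
  by rewrite scale1r => /root_subN.
exfalso; have := @dot_gt0 (a - b).
rewrite linearBl !linearBr /= (dotC b a) in hba * => H.
have /H : a - b <> 0 by move/eqP; rewrite subr_eq0 => /eqP.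
lra.
Qed.

(** The inverse composes the same reflections in reverse order. *)
Lemma weyl_bij {w} : weyl dot Delta w -> exists w',
  [/\ linear w, linear w', cancel w w', cancel w' w
    & forall a, Delta a -> Delta (w a) /\ Delta (w' a)].
Proof.
elim=> [|a {}w Da _ [w' [lw lw' wK w'K wD]]]; first by exists idfun; split.
have rK := reflectionK (rs_neq0 rsD Da).
exists (w' \o reflection dot a); split.
- by move=> k x y /=; rewrite lw reflection_linear.
- by move=> k x y /=; rewrite reflection_linear lw'.
- by move=> x /=; rewrite rK wK.
- by move=> x /=; rewrite w'K rK.
- move=> b Db /=; split; first by apply: (rs_reflection rsD) => //; exact: (wD b Db).1.
  by apply: (wD _ _).2; exact: (rs_reflection rsD).
Qed.

(** If neither [root_sub] for [a + b + c] against [b] or [c], nor for [a] against [- b] or [- c],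
    applies, then [dot (a + b + c) (b + c)] is at most 0 while [dot a (b + c)] is at least 0,
    contradicting [b + c <> 0]. *)
Lemma root_sum3 {a b c} : Delta b -> Delta (b + c) -> Delta c -> Delta a ->
  Delta (a + b + c) -> a + b <> 0 -> a + c <> 0 ->
  Delta (a + b) \/ Delta (a + c).
Proof.
move=> Db Dbc Dc Da Ds ab0 ac0.
have [h|hac] := ltP 0 (dot (a + b + c) b).
  right; have := root_sub Ds Db h; rewrite [a + b + c]addrAC addrK; apply.
  by move/eqP; rewrite -subr_eq0 addrK => /eqP.
have [h|hab] := ltP 0 (dot (a + b + c) c).
  left; have := root_sub Ds Dc h; rewrite addrK; apply.
  by move/eqP; rewrite -subr_eq0 addrK => /eqP.
have s0 := dot_gt0 (rs_neq0 rsD Ds).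
have bc0 := dot_gt0 (rs_neq0 rsD Dbc).
have [h|h1] := ltP (dot a b) 0.
  left; rewrite -[b]opprK; apply: root_sub => //; first exact: rootN.
    by rewrite linearNr /= oppr_gt0.
  by move=> e; apply: ab0; rewrite e addNr.
have [h|h2] := ltP (dot a c) 0.
  right; rewrite -[c]opprK; apply: root_sub => //; first exact: rootN.
    by rewrite linearNr /= oppr_gt0.
  by move=> e; apply: ac0; rewrite e addNr.
by exfalso; move: bc0 hac hab; rewrite !(linearDl, linearDr) /= (dotC c b); lra.
Qed.

(* [dot (a + b) (c + d) > 0], so one of the four products is positive, and
   [c - a = b - d], [d - a = b - c]. *)
Lemma root_sum_exchange {a b c d} : Delta a -> Delta b -> Delta c -> Delta d ->
  Delta (a + b) -> a + b = c + d ->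
  (Delta (c - a) \/ c = a) \/ (Delta (d - a) \/ d = a).
Proof.
move=> Da Db Dc Dd Dab e.
have sub0 x y : Delta x -> Delta y -> 0 < dot x y -> Delta (y - x) \/ y = x.
  move=> Dx Dy h; have [->|/eqP ne] := eqVneq y x; first by right.
  by left; apply: root_sub => //; rewrite dotC.
have ed : d - a = b - c.
  by apply: (addrI (a + c)); rewrite [RHS]addrACA subrr addr0 e [a + c]addrC addrACA subrr addr0.
have ec : c - a = b - d.
  by apply: (addrI (a + d)); rewrite [RHS]addrACA subrr addr0 e [a + d]addrC addrACA subrr addr0 addrC.
have eqd : c = b -> d = a by move=> cb; apply/eqP; rewrite -subr_eq0 ed cb subrr.
have eqc : d = b -> c = a by move=> db; apply/eqP; rewrite -subr_eq0 ec db subrr.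
have := dot_gt0 (rs_neq0 rsD Dab); rewrite {2}e linearDl !linearDr /= => h.
have [ac|ac] := ltP 0 (dot a c); first by left; exact: sub0.
have [ad|ad] := ltP 0 (dot a d); first by right; exact: sub0.
have [bc|bc] := ltP 0 (dot b c).
  right; have [/root_subN|/eqd] := sub0 _ _ Db Dc bc; last by right.
  by rewrite -ed; left.
have [bd|bd] := ltP 0 (dot b d); last by exfalso; clear -h ac ad bc bd; lra.
left; have [/root_subN|/eqc] := sub0 _ _ Db Dd bd; last by right.
by rewrite -ec; left.
Qed.

End RootSystem.

(** * Positive roots, heights and simple roots *)

Section PositiveRoots.
Context {R : realFieldType} {V : vectType R} {dot : {dot V for idfun}}.
Context {Delta P : set V} {v : V}.
Context (rsD : root_system dot Delta) (cryD : crystallographic dot Delta).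
Context (v_reg : forall a, Delta a -> dot v a <> 0).
Context (defP : P = [set a | Delta a /\ 0 < dot v a]).
Implicit Types (a b m g : V) (t : seq V).

Lemma pos_root {a} : P a -> Delta a.
Proof. by rewrite defP => -[]. Qed.

Lemma pos_height {a} : P a -> 0 < dot v a.
Proof. by rewrite defP => -[]. Qed.

Lemma posI {a} : Delta a -> 0 < dot v a -> P a.
Proof. by rewrite defP. Qed.

Lemma pos_or_neg {a} : Delta a -> P a \/ P (- a).
Proof.
move=> Da; have /eqP := v_reg _ Da; rewrite neq_lt => /orP[h|h]; last by left; apply: posI.
by right; apply: posI; [exact: (rootN rsD) | rewrite linearNr /= oppr_gt0].
Qed.

Lemma posD_neq0 {a b} : P a -> P b -> a + b <> 0.
Proof.
move=> /pos_height ha /pos_height hb /(congr1 (dot v)).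
by rewrite linearDr linear0r /= => h; move: ha hb; lra.
Qed.

Lemma posN {a} : P a -> ~ P (- a).
Proof. by move=> Pa /(posD_neq0 Pa); rewrite subrr. Qed.

Lemma height_sum_ge0 t :
  (forall a, a \in t -> simple_roots P a) -> 0 <= dot v (\sum_(a <- t) a).
Proof.
move=> ht; rewrite dot_sumr big_seq; apply: sumr_ge0 => a /ht[Pa _].
exact: ltW (pos_height Pa).
Qed.

(** A list with repetitions replaces the coefficients, so that inductions can remove one simple root
    at a time. *)
Lemma root_leP m g : root_le (simple_roots P) m g <->
  exists2 t, (forall a, a \in t -> simple_roots P a) & g - m = \sum_(a <- t) a.
Proof.
split=> [[s [c [hs ->]]]|[t ht e]]; last first.
  by exists t, (fun=> 1%N).
exists (flatten [seq nseq (c a) a | a <- s]).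
  by move=> a /flatten_mapP[b bs]; rewrite mem_nseq => /andP[_ /eqP->]; exact: hs.
by rewrite big_flatten big_map; apply: eq_bigr => a _; rewrite big_nseq iter_addr_0.
Qed.

(** Heights [dot v a] lie in an ordered field, so the induction runs on [ht], the number of listed
    roots of smaller height. *)
Lemma pos_simple_sum {a} : P a ->
  exists2 t, (forall b, b \in t -> simple_roots P b) & a = \sum_(b <- t) b.
Proof.
have /finite_seqP[r rE] := rs_finite rsD.
pose ht a := count (fun b => dot v b < dot v a) r.
have ht_lt b c : P b -> dot v b < dot v c -> (ht b < ht c)%N.
  move=> Pb bc; have br : b \in r by have := pos_root Pb; rewrite rE.
  (* For strictness, [b] is counted together with the roots below it: all of them are below [c]. *)
  pose p x := dot v x < dot v b.
  have pb : count (predI p (pred1 b)) r = 0%N.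
    apply/eqP; rewrite -leqn0 leqNgt -has_count; apply/hasPn => x _ /=.
    by apply/negP => /andP[/[swap] /eqP->]; rewrite /p ltxx.
  have -> : ht b = (count (predU p (pred1 b)) r - count_mem b r)%N.
    by rewrite -[LHS]/(count p r) -[LHS](addnK (count_mem b r)) -count_predUI pb addn0.
  apply: (@leq_trans (count (predU p (pred1 b)) r)).
    by rewrite ltn_subrL -!has_count; apply/andP; split; apply/hasP; exists b => //=; rewrite eqxx ?orbT.
  by apply: sub_count => x /= /orP[/lt_trans->|/eqP->].
have [n] := ubnP (ht a); elim: n a => // n IH a /ltnSE-htn Pa.
have [sa|nsa] := pselect (simple_roots P a).
  by exists [:: a]; [move=> b; rewrite inE => /eqP-> | rewrite big_seq1].
have [b [c [Pb Pc ae]]] : exists b c, [/\ P b, P c & a = b + c].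
  by apply: contrapT => h; apply: nsa.
have hb := pos_height Pb; have hc := pos_height Pc.
have hv : dot v a = dot v b + dot v c by rewrite ae linearDr.
have [|t1 h1 e1] := IH b _ Pb; first by apply: leq_trans htn; apply: ht_lt => //; lra.
have [|t2 h2 e2] := IH c _ Pc; first by apply: leq_trans htn; apply: ht_lt => //; lra.
exists (t1 ++ t2); last by rewrite big_cat -e1 -e2.
by move=> x; rewrite mem_cat => /orP[/h1|/h2].
Qed.

Lemma pos_root_le {m g} : P (g - m) -> root_le (simple_roots P) m g.
Proof. by move=> /pos_simple_sum ?; apply/root_leP. Qed.

(* [g - m] has a positive product with itself, hence with one of its simple
   summands [a]; then [dot g a > 0] or [dot m a < 0]. *)
Lemma root_le_step {m g t} : P m -> P g -> m <> g ->
  (forall a, a \in t -> simple_roots P a) -> g - m = \sum_(a <- t) a ->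
  exists2 a, a \in t &
    (P (g - a) /\ g - a - m = \sum_(b <- rem a t) b) \/
    (P (m + a) /\ g - (m + a) = \sum_(b <- rem a t) b).
Proof.
move=> Pm Pg mg ht e.
have : 0 < dot (g - m) (\sum_(a <- t) a).
  by rewrite -e; apply: dot_gt0 => /eqP; rewrite subr_eq0 => /eqP/esym.
move=> /dot_sum_gt0[a at_ h]; exists a => //.
have e' : g - a - m = \sum_(b <- rem a t) b.
  by move: e; rewrite (big_rem a) //= addrAC => ->; rewrite addrC addKr.
have [Pa _] := ht _ at_.
have ha := pos_height Pa; have hm := pos_height Pm.
(* Hence [g - a] is at least as high as [m], which makes it nonzero and positive. *)
have hr : 0 <= dot v (g - a - m).
  by rewrite e'; apply: height_sum_ge0 => b /mem_rem; exact: ht.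
have [ga|ga] := ltP 0 (dot g a).
  left; split=> //; apply: posI; last first.
    by move: hr; rewrite linearBr /=; lra.
  apply: (root_sub rsD cryD) => //; [exact: pos_root|exact: pos_root|].
  move=> ea; move: hr; rewrite ea subrr sub0r linearNr /=; lra.
right; split; last by rewrite opprD addrCA addrC -e' addrAC.
apply: posI; last by rewrite linearDr /=; lra.
rewrite -[a]opprK; apply: (root_sub rsD cryD).
- exact: pos_root.
- exact: (rootN rsD) (pos_root Pa).
- by rewrite linearNr /=; move: h; rewrite linearBl /=; lra.
- by move=> ea; apply: (posN Pa); rewrite -ea.
Qed.

(** * Degrees of roots in the grading *)

Context {D : int -> set V}.
Context (grD : grading Delta D) (compD : compatible dot D P).

Lemma deg_exists {a} : Delta a -> exists i, D i a.
Proof. by rewrite -(gr_cover grD) => -[i _ ai]; exists i. Qed.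

Lemma deg_root {i a} : D i a -> Delta a.
Proof. by move=> ai; rewrite -(gr_cover grD); exists i. Qed.

Lemma deg_inj {i j a} : D i a -> D j a -> i = j.
Proof. by move=> ai aj; apply: (gr_disjoint grD) => //; exists a. Qed.

Lemma deg_ge1_pos {i a} : 1 <= i -> D i a -> P a.
Proof. by move=> i1 ai; have [P0 [_ ->]] := compD; right; exists i. Qed.

Lemma deg_ge0 {i a} : P a -> D i a -> 0 <= i.
Proof.
have [P0 [[u [_ ->]] ->]] := compD.
by move=> [[a0 _]|[j /= j1 aj]] ai; [rewrite (deg_inj ai a0)|rewrite (deg_inj ai aj); lia].
Qed.

Lemma deg_add {i j k a b} : D i a -> D j b -> D k (a + b) -> k = i + j.
Proof.
move=> ai bj abk; apply: (deg_inj abk); apply: (gr_add grD) => //.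
exact: deg_root abk.
Qed.

Lemma degD {i j a b} : D i a -> D j b -> Delta (a + b) -> D (i + j) (a + b).
Proof. exact: (gr_add grD). Qed.

Lemma degB {i j a b} : D i a -> D j b -> Delta (a - b) -> D (i - j) (a - b).
Proof.
move=> ai bj Dab; have [k abk] := deg_exists Dab.
suff -> : i - j = k by [].
have := deg_add abk bj; rewrite subrK => /(_ _ ai) ->; lia.
Qed.

(** Degrees add only along sums that are roots, so [m] is joined to [g] through positive roots by
    [root_le_step]; each simple root used has degree at least 0. *)
Lemma root_le_deg {m g i j} : P m -> P g -> D i m -> D j g ->
  root_le (simple_roots P) m g -> i <= j.
Proof.
move=> Pm Pg mi gj /root_leP[t ht e].
have [n] := ubnP (size t).
elim: n => // n IH in t m g i j Pm Pg mi gj ht e * => /ltnSE-tn.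
have [mg|mg] := eqVneq m g; first by rewrite mg in mi; rewrite (deg_inj mi gj).
have [a at_ Ha] := root_le_step Pm Pg (elimN eqP mg) ht e.
have htr b : b \in rem a t -> simple_roots P b by move=> /mem_rem; exact: ht.
have rn : (size (rem a t) < n)%N.
  by apply: leq_trans tn; rewrite size_rem // prednK //; case: (t) at_.
have [Pa _] := ht _ at_; have [k ak] := deg_exists (pos_root Pa).
have k0 := deg_ge0 Pa ak.
case: Ha => -[Pga e'].
  have gak := degB gj ak (pos_root Pga).
  by have := IH _ _ _ _ _ Pm Pga mi gak htr e' rn; lia.
have mak := degD mi ak (pos_root Pga).
by have := IH _ _ _ _ _ Pga Pg mak gj htr e' rn; lia.
Qed.

(** * The complement of a lower ideal and its powers *)

Context {I : set V} (lowI : lower_ideal (simple_roots P) (D 1) I).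
Local Notation Ic := (D 1 `\` I).
Local Notation "J ^[ k ]" := (root_power Delta J k) (at level 2).

Lemma Ic_pos {a} : Ic a -> P a.
Proof. by move=> [a1 _]; exact: deg_ge1_pos a1. Qed.

Lemma Ic_up {m g} : Ic m -> D 1 g -> root_le (simple_roots P) m g -> Ic g.
Proof. by move=> [m1 mI] g1 mg; split=> // gI; apply: mI; exact: lowI.2 gI m1 mg. Qed.

Lemma Ic_addl {a b} : D 0 a -> P a -> Ic b -> Delta (a + b) -> Ic (a + b).
Proof.
move=> a0 Pa bI Dab; have [b1 _] := bI.
apply: (Ic_up bI); first by have := degD a0 b1 Dab; rewrite add0r.
by apply: pos_root_le; rewrite addrK.
Qed.

(** A step down from [g] gives the decomposition at once; a step up replaces [m] by [m + a], still
    in [Ic]. *)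
Lemma Ic_not_minimal {m g} : Ic m -> D 1 g -> m <> g ->
  root_le (simple_roots P) m g ->
  exists a b, [/\ P a, D 0 a, Ic b & g = a + b].
Proof.
move=> mI g1 mg /root_leP[t ht e].
have [n] := ubnP (size t).
elim: n => // n IH in t m mI mg ht e * => /ltnSE-tn.
have Pg := deg_ge1_pos (lexx _) g1; have Pm := Ic_pos mI; have [m1 _] := mI.
have [a at_ Ha] := root_le_step Pm Pg mg ht e.
have htr b : b \in rem a t -> simple_roots P b by move=> /mem_rem; exact: ht.
have rn : (size (rem a t) < n)%N.
  by apply: leq_trans tn; rewrite size_rem // prednK //; case: (t) at_.
have [Pa _] := ht _ at_; have [k ak] := deg_exists (pos_root Pa).
have k0 := deg_ge0 Pa ak.
case: Ha => -[Pb e'].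
  have leb : root_le (simple_roots P) m (g - a) by apply/root_leP; exists (rem a t).
  have gak := degB g1 ak (pos_root Pb).
  have := root_le_deg Pm Pb m1 gak leb => kle.
  (* [g - a] has degree [1 - k], which is at least the degree 1 of [m]. *)
  have {kle}k_eq : k = 0 by lia.
  rewrite k_eq subr0 in gak; rewrite k_eq in ak.
  exists a, (g - a); split=> //; last by rewrite addrC subrK.
  exact: Ic_up leb.
have mak := degD m1 ak (pos_root Pb).
have leb : root_le (simple_roots P) (m + a) g by apply/root_leP; exists (rem a t).
have := root_le_deg Pb Pg mak g1 leb => kle.
have {kle}k_eq : k = 0 by lia.
rewrite k_eq addr0 in mak; rewrite k_eq in ak.
have [eg|neg] := eqVneq (m + a) g; first by exists a, m; split=> //; rewrite -eg addrC.
apply: (IH _ _ _ (elimN eqP neg) htr e' rn).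
by rewrite addrC; apply: Ic_addl => //; rewrite addrC; exact: pos_root.
Qed.

Lemma root_power_deg {k a} : Ic^[k.+1] a -> D k.+1%:Z a.
Proof.
elim: k a => [|k IH] a; first by case.
case=> -[b [b1 _] [c /IH ck <-]] Dbc; have := degD b1 ck Dbc.
by congr (D _ _); lia.
Qed.

Lemma root_power_closure {k a} : Ic^[k.+1] a -> root_closure Delta Ic a.
Proof. by move=> h; exists k.+1. Qed.

(** The degree of a root determines the only power that can contain it. *)
Lemma root_closure_deg {k a} : root_closure Delta Ic a -> D k.+1%:Z a -> Ic^[k.+1] a.
Proof.
move=> [[|j] //= _ aj] ak; have [ejk] := deg_inj (root_power_deg aj) ak.
by rewrite -ejk.
Qed.

Lemma root_powerS {k a b} : Ic a -> Ic^[k.+1] b -> Delta (a + b) -> Ic^[k.+2] (a + b).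
Proof. by move=> aI bk Dab; split=> //; exists a => //; exists b. Qed.

(** For [b = c + d], [root_sum3] lets [a] be absorbed into [c] or into [d]. *)
Lemma root_power_addl {k a b} : P a -> D 0 a -> Ic^[k.+1] b -> Delta (a + b) ->
  Ic^[k.+1] (a + b).
Proof.
move=> Pa a0; elim: k b => [|k IH] b bk Dab; first exact: Ic_addl.
have [[c cI [d dk cd]] Db] := bk.
have Pd : P d by apply: deg_ge1_pos (root_power_deg dk).
have Pc := Ic_pos cI.
rewrite -cd addrA in Dab *.
have Dcd : Delta (c + d) by rewrite cd.
have [||Dac|Dad] := root_sum3 rsD cryD (pos_root Pc) Dcd (pos_root Pd) (pos_root Pa) Dab.
- exact: posD_neq0.
- exact: posD_neq0.
- by apply: root_powerS => //; exact: Ic_addl.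
- by rewrite addrAC [_ + c]addrC in Dab *; apply: root_powerS => //; exact: IH.
Qed.

(** Were [g - c] positive, [c] would lie below [g], and minimality would force [c = g]. *)
Lemma minimal_sub {g c} : minimal_in (simple_roots P) Ic g -> Ic c ->
  Delta (c - g) -> P (c - g) /\ D 0 (c - g).
Proof.
move=> [[g1 _] gmin] cI Dcg; have [c1 _] := cI.
split; last by have := degB c1 g1 Dcg; rewrite subrr.
have [//|] := pos_or_neg Dcg; rewrite opprB => /pos_root_le/(gmin _ cI) cg.
by move: Dcg => /(rs_neq0 rsD); rewrite cg subrr.
Qed.

Lemma minimal_exchange {k g b c d} : minimal_in (simple_roots P) Ic g ->
  Delta b -> Ic c -> Ic^[k.+1] d -> g + b = c + d -> Delta (c - g) \/ c = g ->
  Ic^[k.+1] b.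
Proof.
move=> gmin Db cI dk e [Dcg|cg]; last by move: e; rewrite cg => /addrI ->.
have eb : b = (c - g) + d by apply: (addrI g); rewrite e addrA subrKC.
have [Pcg cg0] := minimal_sub gmin cI Dcg.
by rewrite eb; apply: root_power_addl => //; rewrite -eb.
Qed.

Lemma root_power_sub_minimal {k g b} : minimal_in (simple_roots P) Ic g ->
  D k.+1%:Z b -> Ic^[k.+2] (g + b) -> Ic^[k.+1] b.
Proof.
move=> gmin; have [[g1 _] _] := gmin.
elim: k b => [|k IH] b bk [[c cI [d dk /esym e]] Dgb]; have Db := deg_root bk.
  (* Here [d] lies in [Ic] too, so [c] and [d] play symmetric roles. *)
  have [||h|h] := root_sum_exchange rsD cryD (deg_root g1) Db _ _ Dgb e.
  - exact: pos_root (Ic_pos cI).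
  - exact: pos_root (Ic_pos dk).
  - exact: (@minimal_exchange 0 _ _ _ _ gmin Db cI dk e h).
  - by rewrite [c + d]addrC in e; exact: (@minimal_exchange 0 _ _ _ _ gmin Db dk cI e h).
have {}dk : Ic^[k.+2] d := dk; have dk' := root_power_deg dk.
have [||h|[Ddg|dg]] := root_sum_exchange rsD cryD (deg_root g1) Db _ _ Dgb e.
- exact: pos_root (Ic_pos cI).
- exact: deg_root dk'.
- exact: minimal_exchange gmin Db cI dk e h.
- have eb : b = c + (d - g) by apply: (addrI g); rewrite e addrCA subrKC.
  rewrite eb; apply: root_powerS => //; last by rewrite -eb.
  apply: IH; last by rewrite subrKC.
  by have := degB dk' g1 Ddg; congr (D _ _); lia.
(* [d = g] is impossible: [d] has degree at least 2. *)
- by have := deg_inj g1 (eq_ind _ (D _) dk' _ dg); lia.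
Qed.

End PositiveRoots.

(** * Minimal elements and their images under [w_max] *)

Theorem theorem4p2 (R : realFieldType) (V : vectType R)
    (dot : {dot V for idfun}) (Delta : set V) (D : int -> set V)
    (P I : set V) (g : V) (w_max : V -> V) :
  root_system dot Delta ->
  reduced Delta ->
  crystallographic dot Delta ->
  irreducible_roots dot Delta ->
  grading Delta D ->
  positive_system dot Delta P ->
  compatible dot D P ->
  lower_ideal (simple_roots P) (D 1) I ->
  is_w_max dot Delta D P I w_max ->
  D 1 g ->
  minimal_in (simple_roots P) (D 1 `\` I) g <-> simple_roots P (w_max g).
Proof.
move=> rsD _ cryD _ grD [v [v_reg defP]] compD lowI [/(weyl_bij rsD)[w' [lw lw' wK w'K wD]] invw] g1.
have wDl a b : w_max (a + b) = w_max a + w_max b by have := lw 1 a b; rewrite !scale1r.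
have w'Dl a b : w' (a + b) = w' a + w' b by have := lw' 1 a b; rewrite !scale1r.
have w0 : w_max 0 = 0 by apply: (addrI (w_max 0)); rewrite -wDl !addr0.
have wN a : w_max (- a) = - w_max a.
  by apply/eqP; rewrite -addr_eq0 -wDl addNr w0.
have Pg : P g by exact: (deg_ge1_pos compD (lexx _) g1).
have invE a : P a -> P (- w_max a) <-> inversions P w_max a.
  move=> Pa; split=> [Pwa|[_ [b Pb <-]]]; last by rewrite opprK.
  by split=> //; exists (- w_max a) => //; rewrite opprK.
have w_pos a : P a -> D 0 a \/ root_closure Delta (D 1 `\` I) a -> P (w_max a).
  move=> Pa ha; have [//|/(invE _ Pa)] := pos_or_neg rsD v_reg defP (wD _ (pos_root defP Pa)).1.
  rewrite invw => -[[i /= i1 ai] nc]; case: ha => // a0.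
  by move: i1; rewrite (deg_inj grD ai a0).
split=> [gmin|[Pwg nwg]].
  have gI := gmin.1.
  split; first by apply: w_pos => //; right; exists 1%N.
  (* a negative summand [b] of [g = b + c] would make [c = g + (- b)] lie in the
     closure of [I^c], hence also [- b], although [- b] is an inversion *)
  have no_neg b c : P (- b) -> P (w_max b) -> P c -> P (w_max c) -> g = b + c -> False.
    move=> Pnb Pwb Pc Pwc e.
    have : inversions P w_max (- b) by apply/invE => //; rewrite wN opprK.
    rewrite invw => -[[[[|k]|//] //= _ nbk] ncl].
    have ec : c = g + - b by rewrite e addrAC subrr add0r.
    have Dc := pos_root defP Pc.
    have ck : D k.+2%:Z c.
      by rewrite ec in Dc *; have := degD grD g1 nbk Dc; congr (D _ _); lia.
    apply: ncl; apply: root_power_closure.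
    apply: (root_power_sub_minimal rsD cryD v_reg defP grD compD lowI gmin nbk).
    rewrite -ec; apply: (root_closure_deg grD) => //.
    apply: contrapT => nc; apply: (posN defP Pwc).
    suff: inversions P w_max c by move/(invE _ Pc).
    by rewrite invw; split=> //; exists k.+2%:Z.
  (* Here [c] has degree 1 and lies below [g]. It is not an inversion, so it lies in the complement
     of [I]; minimality gives [c = g], hence [b = 0]. *)
  have no_pos b c : P b -> P (w_max b) -> D 0 b -> P c -> P (w_max c) -> g = b + c -> False.
    move=> Pb Pwb b0 Pc Pwc e.
    have c1 : D 1 c.
      have ec : c = g - b by rewrite e addrAC subrr add0r.
      by have := pos_root defP Pc; rewrite ec => /(degB grD g1 b0); rewrite subr0.
    have cI : (D 1 `\` I) c.
      split=> // cI; apply: (posN defP Pwc).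
      suff: inversions P w_max c by move/(invE _ Pc).
      rewrite invw; split; first by exists 1.
      by move=> /(root_closure_deg grD (k := 0)) /(_ c1) [].
    have : c = g.
      by apply: gmin.2 cI _; apply: (pos_root_le rsD defP); rewrite e addrK.
    by move=> cg; move: e; rewrite cg => /eqP; rewrite -subr_eq0 opprD addrCA subrr addr0 oppr_eq0 => /eqP; exact: (rs_neq0 rsD (pos_root defP Pb)).
  move=> [b' [c' [Pb' Pc' e']]].
  have Db : Delta (w' b') by exact: (wD _ (pos_root defP Pb')).2.
  have Dc : Delta (w' c') by exact: (wD _ (pos_root defP Pc')).2.
  have eg : g = w' b' + w' c' by rewrite -w'Dl -e' wK.
  have eg' : g = w' c' + w' b' by rewrite addrC.
  rewrite -(w'K b') in Pb'; rewrite -(w'K c') in Pc'.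
  have [Pb|Pb] := pos_or_neg rsD v_reg defP Db; have [Pc|Pc] := pos_or_neg rsD v_reg defP Dc.
  - have [i bi] := deg_exists grD Db; have [j cj] := deg_exists grD Dc.
    have i0 := deg_ge0 grD compD Pb bi; have j0 := deg_ge0 grD compD Pc cj.
    rewrite eg in g1; have ij := deg_add grD bi cj g1.
    (* Two nonnegative degrees with sum 1. *)
    have [i_0|j_0] : i = 0 \/ j = 0 by lia.
      by rewrite i_0 in bi; exact: no_pos bi Pc Pc' eg.
    by rewrite j_0 in cj; exact: no_pos cj Pb Pb' eg'.
  - exact: no_neg Pc Pc' Pb Pb' eg'.
  - exact: no_neg Pb Pb' Pc Pc' eg.
  (* Two negative summands would make [- g] positive. *)
  - apply: (posN defP Pg); rewrite eg opprD; apply: (posI defP).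
      by rewrite -opprD -eg; exact: (rootN rsD) (pos_root defP Pg).
    by rewrite linearDr /= addr_gt0 // (pos_height defP).
(* As [w_max g] is positive, [g] is not an inversion; in degree 1 the closure is just the complement
   of [I]. *)
have ncl : root_closure Delta (D 1 `\` I) g.
  apply: contrapT => ncl; apply: (posN defP Pwg).
  suff: inversions P w_max g by move/(invE _ Pg).
  by rewrite invw; split=> //; exists 1.
have gI : (D 1 `\` I) g := root_closure_deg grD (k := 0) ncl g1.
split=> // m mI mg; apply: contrapT => neq; apply: nwg.
have [a [b [Pa a0 bI e]]] := Ic_not_minimal rsD cryD defP grD compD lowI mI g1 neq mg.
exists (w_max a), (w_max b); split; last by rewrite e wDl.
  by apply: (w_pos a) => //; left.
by apply: (w_pos b); [exact: (Ic_pos compD bI) | right; exists 1%N].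
Qed.
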